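(* Let $M\in\mathbb{R}^{m\times n}_+$ be a nonnegative matrix. For $V\in\mathbb{R}^{m\times r}$, $W\in\mathbb{R}^{r\times n}$ with $V,W\ge\mathbf 0$, $\|M-VW\|_F$ is nonincreasing under $$V_{:k}\leftarrow V_{:k}\circ\frac{[MW_{k:}^T]}{[VWW_{k:}^T]},\qquad W_{k:}\leftarrow W_{k:}\circ\frac{[V_{:k}^TM]}{[V_{:k}^TVW]},\qquad\forall k,$$ i.e. under the update of any single column of $V$ or any single row of $W$ using the multiplicative updates $V\leftarrow V\circ\frac{[MW^T]}{[VWW^T]}$, $W\leftarrow W\circ\frac{[V^TM]}{[V^TVW]}$ (all other entries of $V$ and $W$ being kept fixed).
   Context: $V_{:k}$ is the $k$-th column of $V$ and $W_{k:}$ the $k$-th row of $W$. $\circ$ is the component-wise product and $\frac{[A]}{[B]}$ is component-wise division (defined where the entries of $B$ are nonzero). Inequalities are entrywise. *)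

(* Defs.v *)
From mathcomp Require Import all_boot all_order all_algebra.
From mathcomp Require Import reals.

Set Implicit Arguments.
Unset Strict Implicit.
Unset Printing Implicit Defensive.

Import Order.TTheory GRing.Theory Num.Theory.
Local Open Scope ring_scope.

Definition nonneg_mx (R : realType) (m n : nat) (A : 'M[R]_(m, n)) : Prop :=
  forall i j, 0 <= A i j.

Definition nonzero_entries (R : realType) (m n : nat) (A : 'M[R]_(m, n)) : Prop :=
  forall i j, A i j != 0.

Definition frobenius (R : realType) (m n : nat) (A : 'M[R]_(m, n)) : R :=
  Num.sqrt (\sum_i \sum_j A i j ^+ 2).

Definition cmul (R : realType) (m n : nat) (A B : 'M[R]_(m, n)) : 'M[R]_(m, n) :=
  map2_mx (fun x y => x * y) A B.

(* Division in [R] is total, so this is the intended operation only when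
   [nonzero_entries B] holds. *)
Definition cdiv (R : realType) (m n : nat) (A B : 'M[R]_(m, n)) : 'M[R]_(m, n) :=
  map2_mx (fun x y => x / y) A B.

Definition set_col (R : realType) (m n : nat) (k : 'I_n) (c : 'cV[R]_m)
    (A : 'M[R]_(m, n)) : 'M[R]_(m, n) :=
  \matrix_(i, j) (if j == k then c i 0 else A i j).

Definition set_row (R : realType) (m n : nat) (k : 'I_m) (v : 'rV[R]_n)
    (A : 'M[R]_(m, n)) : 'M[R]_(m, n) :=
  \matrix_(i, j) (if i == k then v 0 j else A i j).

Definition mu_col (R : realType) (m n r : nat) (M : 'M[R]_(m, n))
    (V : 'M[R]_(m, r)) (W : 'M[R]_(r, n)) (k : 'I_r) : 'M[R]_(m, r) :=
  set_col k
    (cmul (col k V) (cdiv (M *m (row k W)^T) (V *m W *m (row k W)^T))) V.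

Definition mu_row (R : realType) (m n r : nat) (M : 'M[R]_(m, n))
    (V : 'M[R]_(m, r)) (W : 'M[R]_(r, n)) (k : 'I_r) : 'M[R]_(r, n) :=
  set_row k
    (cmul (row k W) (cdiv ((col k V)^T *m M) ((col k V)^T *m V *m W))) W.

(* Main.v *)
(* Updating column k of V changes each row of VW separately. In row i, put
   x = V_ik, w = W_k:, p = (VW)_i:, b = M_i:, and D = <p, w>, t = <b, w> / D.
   The update adds x (t - 1) w to p and so decreases the squared error by
   x (t - 1)^2 (2 D - x |w|^2). Nonnegativity gives p >= x w, hence
   D >= x |w|^2 and the decrease is nonnegative. The row update is the column
   update of the transposed problem. *)

Require Import Defs.
From mathcomp Require Import all_boot all_order all_algebra.
From mathcomp Require Import reals ring lra.

Set Implicit Arguments.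
Unset Strict Implicit.
Unset Printing Implicit Defensive.

Import Order.TTheory GRing.Theory Num.Theory.
Local Open Scope ring_scope.

(** One row of the column update, with the row of [V *m W] abstracted to [p]: all that is kept of
    the product is the bound [x * w j <= p j]. *)
Lemma sum_sqr_mu_le (R : realFieldType) (I : finType) (x : R) (w p b : I -> R) :
  0 <= x -> (forall j, 0 <= w j) -> (forall j, x * w j <= p j) ->
  \sum_j p j * w j != 0 ->
  \sum_j (b j - (p j + x * ((\sum_j b j * w j) / (\sum_j p j * w j) - 1) * w j)) ^+ 2
    <= \sum_j (b j - p j) ^+ 2.
Proof.
move=> x0 w0 xwp; set D := \sum_j p j * w j => D0.
set N := \sum_j b j * w j; set t := N / D.
have xSD : x * \sum_j w j ^+ 2 <= D.
  rewrite mulr_sumr; apply: ler_sum => j _.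
  by rewrite expr2 mulrA ler_wpM2r.
have S0 : 0 <= \sum_j w j ^+ 2 by apply: sumr_ge0 => j _; exact: sqr_ge0.
have ND : N = t * D by rewrite /t divfK.
have -> : \sum_j (b j - (p j + x * (t - 1) * w j)) ^+ 2 =
    \sum_j (b j - p j) ^+ 2
      - x * (t - 1) ^+ 2 * (2 * D - x * \sum_j w j ^+ 2).
  (* Expanding the square gives the cross term [N - D], which equals [(t - 1) * D] because
     [N = t * D]. *)
  transitivity (\sum_j (b j - p j) ^+ 2 - 2 * (x * (t - 1)) * (N - D)
      + (x * (t - 1)) ^+ 2 * \sum_j w j ^+ 2).
    rewrite /N /D -sumrB !mulr_sumr -sumrB -big_split /=.
    by apply: eq_bigr => j _; ring.
  by rewrite ND; ring.
rewrite gerBl; apply: mulr_ge0; first by rewrite mulr_ge0 ?sqr_ge0.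
(* From [0 <= S <= D] follows [S <= 2 * D]. *)
move: (mulr_ge0 x0 S0) xSD; set S := x * _; lra.
Qed.

(** Only the [k]-th summand of each entry changes, so the product receives a rank-one correction. *)
Lemma mul_set_col (R : realType) (m n r : nat) (V : 'M[R]_(m, r))
    (W : 'M[R]_(r, n)) (k : 'I_r) (c : 'cV[R]_m) i j :
  (set_col k c V *m W) i j = (V *m W) i j + (c i 0 - V i k) * W k j.
Proof.
rewrite !mxE (bigD1 k) //= [in RHS](bigD1 k) //= !mxE eqxx.
rewrite (eq_bigr (fun l => V i l * W l j)) => [|l /negPf lk]; last first.
  by rewrite mxE lk.
by ring.
Qed.

Lemma frobenius_mu_col_le (R : realType) (m n r : nat) (M : 'M[R]_(m, n))
    (V : 'M[R]_(m, r)) (W : 'M[R]_(r, n)) (k : 'I_r) :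
  nonneg_mx V -> nonneg_mx W ->
  nonzero_entries (V *m W *m (row k W)^T) ->
  frobenius (M - mu_col M V W k *m W) <= frobenius (M - V *m W).
Proof.
(* The square root is monotone and the squared norm is a sum over rows, so it suffices to compare
   row by row. *)
move=> hV hW hD; apply: ler_wsqrtr; apply: ler_sum => i _.
have mul_row (A : 'M[R]_(m, n)) :
    (A *m (row k W)^T) i 0 = \sum_j A i j * W k j.
  by rewrite mxE; apply: eq_bigr => j _; rewrite !mxE.
have D0 := hD i 0; rewrite mul_row in D0.
have VWge j : V i k * W k j <= (V *m W) i j.
  by rewrite mxE (bigD1 k) //= lerDl sumr_ge0 // => l _; rewrite mulr_ge0.
have := sum_sqr_mu_le (M i) (hV i k) (hW k) VWge D0.
rewrite [X in _ -> _ <= X](eq_bigr (fun j => (M i j - (V *m W) i j) ^+ 2));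
  last by move=> j _; rewrite [in LHS]mxE [in LHS]mxE.
congr (_ <= _); apply: eq_bigr => j _.
rewrite [in RHS]mxE [in RHS]mxE mul_set_col.
rewrite [cmul _ _ i 0]mxE [cdiv _ _ i 0]mxE !mul_row [col k V i 0]mxE.
by congr ((_ - (_ + _ * _)) ^+ 2); rewrite mulrBr mulr1.
Qed.

Lemma frobenius_tr (R : realType) (m n : nat) (A : 'M[R]_(m, n)) :
  frobenius A^T = frobenius A.
Proof.
rewrite /frobenius exchange_big /=; congr Num.sqrt.
by apply: eq_bigr => i _; apply: eq_bigr => j _; rewrite mxE.
Qed.

Lemma mu_row_tr (R : realType) (m n r : nat) (M : 'M[R]_(m, n))
    (V : 'M[R]_(m, r)) (W : 'M[R]_(r, n)) (k : 'I_r) :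
  (mu_row M V W k)^T = mu_col M^T W^T V^T k.
Proof.
apply/matrixP => j l; rewrite mxE [LHS]mxE [RHS]mxE; case: eqP => _.
  rewrite [LHS]mxE [RHS]mxE [cdiv _ _ 0 j]mxE [cdiv _ _ j 0]mxE.
  (* Numerator and denominator of the column update for the transposed problem fold into transposes
     of those of the row update. *)
  rewrite -tr_col -!trmx_mul mulmxA.
  by rewrite ![trmx (_ *m _) _ _]mxE !mxE.
by rewrite mxE.
Qed.

Theorem corollary2 (R : realType) (m n r : nat) (M : 'M[R]_(m, n))
    (V : 'M[R]_(m, r)) (W : 'M[R]_(r, n))
    (hM : nonneg_mx M) (hV : nonneg_mx V) (hW : nonneg_mx W) :
  forall k : 'I_r,
    (nonzero_entries (V *m W *m (row k W)^T) ->
       frobenius (M - mu_col M V W k *m W) <= frobenius (M - V *m W)) /\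
    (nonzero_entries ((col k V)^T *m V *m W) ->
       frobenius (M - V *m mu_row M V W k) <= frobenius (M - V *m W)).
Proof.
move=> k; split=> [|hD]; first exact: frobenius_mu_col_le.
rewrite -frobenius_tr -[leRHS]frobenius_tr !linearB /= !trmx_mul mu_row_tr.
apply: frobenius_mu_col_le => [i j|i j|j i]; rewrite ?[_^T _ _]mxE //.
(* The transposed problem has the transposed denominator, so [hD] applies with its indices
   swapped. *)
by rewrite -tr_col -!trmx_mul mulmxA mxE.
Qed.
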